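(* Let $\mathbb{F}$ be a field and let $T$ be a tensor over $\mathbb{F}$, i.e. a $d$-linear map $T\colon V^d\to V$ with $d\ge1$ and $V$ a finite-dimensional $\mathbb{F}$-vector space. If $\mathbf{p}\in V^d$ is an LR-stable point for $T$, then $$\mathrm{PR}(T)\le\|\mathrm{LR}_{\mathbf{p}}(T)\|.$$
   Context: Partition rank: a nonzero $d$-linear map $T\colon V^d\to V$ is reducible if there is a partition $\{1,\ldots,d\}=A\sqcup B$ with $A$ nonempty ($B$ may be empty), an $|A|$-linear form $P\colon V^{|A|}\to\mathbb{F}$ and a $|B|$-linear map $T'\colon V^{|B|}\to V$ (an element of $V$ if $B=\emptyset$) such that $T(\mathbf{x})=P(x_i: i\in A)\cdot T'(x_j: j\in B)$ for all $\mathbf{x}\in V^d$. $\mathrm{PR}(T)$ is the minimum $r$ such that $T$ is a sum of $r$ reducible tensors. (With $V=\mathbb{F}^n$, $T$ corresponds to the $(d+1)$-tensor $(x_1,\ldots,x_{d+1})\mapsto T(x_1,\ldots,x_d)\cdot x_{d+1}$.) Local rank: for $\mathbf{x},\mathbf{p}\in V^d$ and $0\le i\le d$ let $\mathbf{p}\circ_i\mathbf{x}=(p_1,\ldots,p_i,x_{i+1},\ldots,x_d)$. For $i\in\{1,\ldots,d\}$ let $T[\mathbf{x}]_i\colon V\to V$ be the linear map $v\mapsto T(x_1,\ldots,x_{i-1},v,x_{i+1},\ldots,x_d)$. Write $\mathbf{p}\dashv_T\mathbf{x}$ if $T(\mathbf{p}\circ_i\mathbf{x})=0$ for all $1\le i\le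 d-1$. Let $\prec$ be the colexicographic order on $\mathbb{N}^d$: $\mathbf{a}\prec\mathbf{b}$ iff there is $i$ with $a_i<b_i$ and $a_j=b_j$ for all $j>i$. The local rank of $T$ at $\mathbf{p}\in V^d$ is $$\mathrm{LR}_{\mathbf{p}}(T)=\max\nolimits^{\prec}_{\mathbf{x}\in V^d:\ \mathbf{p}\dashv_T\mathbf{x}}\left(\mathrm{rank}\,T[\mathbf{p}\circ_1\mathbf{x}]_1,\ldots,\mathrm{rank}\,T[\mathbf{p}\circ_d\mathbf{x}]_d\right)\in\mathbb{N}^d,$$ the maximum being with respect to $\prec$. The algebraic local rank $\overline{\mathrm{LR}}_{\mathbf{p}}(T)$ is the local rank at $\mathbf{p}$ of $T$ viewed as a tensor over the algebraic closure $\overline{\mathbb{F}}$ (so $\mathbf{x}$ ranges over $(V\otimes\overline{\mathbb{F}})^d$). A point $\mathbf{p}\in V^d$ is LR-stable for $T$ if $\mathrm{LR}_{\mathbf{p}}(T)=\overline{\mathrm{LR}}_{\mathbf{p}}(T)$. For $\mathbf{r}\in\mathbb{N}^d$, $\|\mathbf{r}\|=\sum_{i=1}^d2^{d-i}r_i$. *)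

(* Defs.v *)
From HB Require Import structures.
From mathcomp Require Import all_boot all_order all_algebra.
From mathcomp Require boolp classical_sets.

Set Implicit Arguments.
Unset Strict Implicit.
Unset Printing Implicit Defensive.

Import Order.TTheory GRing.Theory.
Local Open Scope ring_scope.

(* A point of V^I is a finite function {ffun I -> V}; V^d is the case I = 'I_d,
   so that the coordinates 1, ..., d of a point are numbered 0, ..., d - 1. *)
Section Multilinear.
Variables (F : fieldType) (V : lmodType F) (I : finType).
Implicit Types (x : {ffun I -> V}) (i : I).

Definition upd (x : {ffun I -> V}) (i : I) (v : V) : {ffun I -> V} :=
  [ffun j => if j == i then v else x j].

Definition multilinear (W : lmodType F) (T : {ffun I -> V} -> W) : Prop :=
  forall (x : {ffun I -> V}) (i : I) (a : F) (u v : V),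
    T (upd x i (a *: u + v)) = a *: T (upd x i u) + T (upd x i v).

Definition restr (A : {set I}) (x : {ffun I -> V}) :
  {ffun {i : I | i \in A} -> V} := [ffun i => x (val i)].

Lemma updK (x : {ffun I -> V}) i : upd x i (x i) = x.
Proof. by apply/ffunP=> j; rewrite ffunE; case: eqP => [->|]. Qed.

Lemma multilinear0 (W : lmodType F) (T : {ffun I -> V} -> W) x i :
  multilinear T -> x i = 0 -> T x = 0.
Proof.
move=> hT xi0; have := hT x i 1 0 0.
rewrite !scale1r addr0 -xi0 updK => /eqP.
by rewrite -subr_eq0 opprD addrA subrr sub0r oppr_eq0 => /eqP.
Qed.

Lemma multilinear_scale (W : lmodType F) (T : {ffun I -> V} -> W) c :
  multilinear T -> multilinear (fun x => c *: T x).
Proof. by move=> hT x i a u v; rewrite hT scalerDr !scalerA mulrC. Qed.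

Lemma multilinear_sum (W : lmodType F) (J : finType)
    (T : J -> {ffun I -> V} -> W) :
  (forall j, multilinear (T j)) -> multilinear (fun x => \sum_j T j x).
Proof.
move=> hT x i a u v; rewrite scaler_sumr -big_split.
by apply: eq_bigr => j _; apply: hT.
Qed.

Lemma multilinear_lsum (W : lmodType F) (T : {ffun I -> V} -> W) (J : finType)
    (c : J -> F) (b : J -> V) x i :
  multilinear T ->
  T (upd x i (\sum_j c j *: b j)) = \sum_j c j *: T (upd x i (b j)).
Proof.
move=> hT; elim/big_rec2: _ => [|j y1 y2 _ <-]; last exact: hT.
by apply: (@multilinear0 _ _ _ i) => //; rewrite ffunE eqxx.
Qed.

(* A multilinear map is determined by its values on the tuples of vectors of a
   spanning family. *)
Lemma multilinear_ext (W : lmodType F) (J : finType) (b : J -> V)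
    (T T' : {ffun I -> V} -> W) :
  (forall v, exists c : J -> F, v = \sum_j c j *: b j) ->
  multilinear T -> multilinear T' ->
  (forall f : {ffun I -> J}, T [ffun i => b (f i)] = T' [ffun i => b (f i)]) ->
  T =1 T'.
Proof.
move=> hb hT hT' eqT x.
have : forall i, i \notin enum I -> exists j, x i = b j.
  by move=> i; rewrite mem_enum.
elim: (enum I) x => [|i s IHs] x hx.
  have [g hg] : exists g : I -> J, forall i, x i = b (g i).
    by apply: (@fin_all_exists I (fun=> J) (fun i j => x i = b j)) => i; apply: hx.
  have -> : x = [ffun i => b ([ffun i => g i] i)].
    by apply/ffunP=> i; rewrite !ffunE.
  exact: eqT.
have [c xi] := hb (x i).
rewrite -(updK x i) xi !multilinear_lsum //; apply: eq_bigr => j _.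
congr (_ *: _); apply: IHs => k ks; rewrite ffunE.
case: eqP => [_|/eqP ki]; first by exists j.
by apply: hx; rewrite inE negb_or ki.
Qed.

End Multilinear.

Section PartitionRank.
Variables (F : fieldType) (V : vectType F) (d : nat).
Implicit Type T : {ffun 'I_d -> V} -> V.

(* A multilinear form is a multilinear map to the regular module F^o. If
   ~: A is empty, a multilinear map T' on V^(~: A) is just an element of V. *)
Definition reducible T : Prop :=
  [/\ multilinear T, exists x, T x != 0 &
   exists A : {set 'I_d}, A != finset.set0 /\
   exists (P : {ffun {i : 'I_d | i \in A} -> V} -> F^o)
          (T' : {ffun {i : 'I_d | i \in ~: A} -> V} -> V),
     [/\ multilinear P, multilinear T' &
         forall x, T x = P (restr A x) *: T' (restr (~: A) x)]].

Definition sum_of_reducible T (r : nat) : Prop :=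
  exists S : 'I_r -> {ffun 'I_d -> V} -> V,
    (forall k, reducible (S k)) /\ (forall x, T x = \sum_(k < r) S k x).

Definition is_PR T (r : nat) : Prop :=
  sum_of_reducible T r /\ forall s, sum_of_reducible T s -> (r <= s)%N.

(* The default value 0 is never used for multilinear T and d >= 1: see PRP. *)
Definition PR T : nat := classical_sets.xget 0%N (is_PR T).

Lemma is_PR_exists T :
  (0 < d)%N -> multilinear T -> exists r, is_PR T r.
Proof.
move=> d0 hT; suff [r hr] : exists r, sum_of_reducible T r.
  have ex : exists r, boolp.asbool (sum_of_reducible T r).
    by exists r; apply/boolp.asboolP.
  have [m /boolp.asboolP hm minm] := ex_minnP ex.
  by exists m; split=> // s hs; apply: minm; apply/boolp.asboolP.
have hc k : multilinear
    (fun x => (coord (vbasis {:V}) k (T x) : F^o)).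
  by move=> x i a u v; rewrite hT linearP.
suff gen (n : nat) (P : 'I_n -> {ffun 'I_d -> V} -> F^o) (w : 'I_n -> V) :
    (forall k, multilinear (P k)) ->
    exists r, sum_of_reducible (fun x => \sum_(k < n) P k x *: w k) r.
  have [r [S [hS eS]]] := gen _ _ (fun k => (vbasis {:V})`_k) hc.
  exists r, S; split=> // x; rewrite -eS.
  exact: (coord_vbasis (memvf (T x))).
elim: n P w => [|n IHn] P w hP.
  exists 0%N, (fun _ _ => 0); split=> [[]//|x]; by rewrite !big_ord0.
have [r [S [hS eS]]] := IHn (fun k => P (lift ord0 k)) (fun k => w (lift ord0 k))
  (fun k => hP _).
have [nz|z] := boolp.pselect (exists x, P ord0 x *: w ord0 != 0); last first.
  exists r, S; split=> // x; rewrite big_ord_recl -eS.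
  suff -> : P ord0 x *: w ord0 = 0 by rewrite add0r.
  by apply/eqP/negPn/negP=> nz; apply: z; exists x.
exists r.+1, (fun k => if unlift ord0 k is Some j then S j
                       else fun x => P ord0 x *: w ord0); split; last first.
  move=> x; rewrite !big_ord_recl unlift_none eS; congr (_ + _).
  by apply: eq_bigr => j _; rewrite liftK.
move=> k; case: unliftP => [j _|_]; first exact: hS.
split=> //; first by move=> x i a u v; rewrite hP scalerDl scalerA.
exists [set: 'I_d]; split.
  by apply/finset.set0Pn; exists (Ordinal d0); rewrite finset.in_setT.
pose ex (y : {ffun {i : 'I_d | i \in [set: 'I_d]} -> V}) : {ffun 'I_d -> V} :=
  [ffun i => y (exist _ i (finset.in_setT i))].
exists (fun y => P ord0 (ex y)), (fun _ => w ord0); split.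
- move=> y i a u v.
  have eq_upd t : ex (upd y i t) = upd (ex y) (val i) t.
    by apply/ffunP=> j; rewrite !ffunE -val_eqE.
  by rewrite !eq_upd hP.
- by move=> y [i iT]; move: (iT); rewrite finset.setCT finset.inE.
- move=> x; congr (P ord0 _ *: _).
  by apply/ffunP=> j; rewrite !ffunE.
Qed.

Lemma PRP T : (0 < d)%N -> multilinear T -> is_PR T (PR T).
Proof. by move=> d0 hT; apply: classical_sets.xgetPex; apply: is_PR_exists. Qed.

End PartitionRank.

Section Colex.
Variable d : nat.
Implicit Types a b r : {ffun 'I_d -> nat}.

Definition colex_lt a b : bool :=
  [exists i : 'I_d,
    (a i < b i)%N && [forall j : 'I_d, (i < j)%N ==> (a j == b j)]].

Definition colex_le a b : bool := (a == b) || colex_lt a b.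

(* The coordinate i : 'I_d is the (i + 1)-st one, whence the exponent. *)
Definition wnorm r : nat := (\sum_(i < d) 2 ^ (d - i.+1) * r i)%N.

Lemma colex_le_refl : reflexive colex_le.
Proof. by move=> a; rewrite /colex_le eqxx. Qed.

Lemma colex_lt_trans : transitive colex_lt.
Proof.
move=> b a c /existsP[i /andP[ab /forallP hi]] /existsP[j /andP[bc /forallP hj]].
have {}hi (k : 'I_d) : (i < k)%N -> a k = b k by move=> ik; apply/eqP/(implyP (hi k)).
have {}hj (k : 'I_d) : (j < k)%N -> b k = c k by move=> jk; apply/eqP/(implyP (hj k)).
apply/existsP; case: (ltngtP i j) => [ij|ji|/val_inj ij].
- exists j; rewrite hi // bc; apply/forallP=> k; apply/implyP=> jk.
  by rewrite hi ?hj // (ltn_trans ij).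
- exists i; rewrite -hj // ab; apply/forallP=> k; apply/implyP=> ik.
  by rewrite hi ?hj // (ltn_trans ji).
- move: bc hj; rewrite -ij => bc hj.
  exists i; rewrite (ltn_trans ab bc); apply/forallP=> k; apply/implyP=> ik.
  by rewrite hi ?hj.
Qed.

Lemma colex_le_trans : transitive colex_le.
Proof.
move=> b a c /orP[/eqP-> //|ab] /orP[/eqP<-|bc]; first by rewrite /colex_le ab orbT.
by rewrite /colex_le (colex_lt_trans ab bc) orbT.
Qed.

Lemma colex_le_total : total colex_le.
Proof.
move=> a b; have [->|ab] := eqVneq a b; first by rewrite colex_le_refl.
have /existsP[i0 hi0] : [exists i, a i != b i].
  rewrite -[X in is_true X]negbK negb_exists; apply: contra ab => /forallP h.
  by apply/eqP/ffunP=> i; apply/eqP/negPn.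
pose i := [arg max_(k > i0 | a k != b k) (k : nat)].
have [neq hi] : a i != b i /\ forall j : 'I_d, (i < j)%N -> a j = b j.
  rewrite /i; case: arg_maxnP => // k kn kmax; split=> // j kj.
  by apply/eqP/negPn/negP=> /kmax /=; rewrite leqNgt kj.
case: (ltngtP (a i) (b i)) neq => // [lt|lt] _; apply/orP; [left|right];
  apply/orP; right; apply/existsP; exists i; rewrite lt;
  apply/forallP=> j; apply/implyP=> /hi ->; exact: eqxx.
Qed.

Lemma colex_le_anti : antisymmetric colex_le.
Proof.
move=> a b /andP[/orP[/eqP//|ab] /orP[/eqP//|ba]].
have /existsP[i /andP[]] := colex_lt_trans ab ba; by rewrite ltnn.
Qed.

End Colex.

Section LocalRank.
Variables (F : fieldType) (V : vectType F) (d : nat).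
Implicit Types (T : {ffun 'I_d -> V} -> V) (x p : {ffun 'I_d -> V}).

(* p o_i x = (p_1, ..., p_i, x_{i+1}, ..., x_d) for 0 <= i <= d *)
Definition hyb p (i : nat) x : {ffun 'I_d -> V} :=
  [ffun j : 'I_d => if (j < i)%N then p j else x j].

(* rank of T[x]_{i+1} *)
Definition slice_rank T x (i : 'I_d) : nat :=
  \dim (limg (linfun (fun v : V => T (upd x i v)))).

(* p -|_T x *)
Definition vanishes_along T p x : Prop :=
  forall i : nat, (0 < i < d)%N -> T (hyb p i x) = 0.

Definition rank_vector T p x : {ffun 'I_d -> nat} :=
  [ffun i : 'I_d => slice_rank T (hyb p i.+1 x) i].

Definition is_LR T p (r : {ffun 'I_d -> nat}) : Prop :=
  (exists x, vanishes_along T p x /\ rank_vector T p x = r) /\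
  (forall x, vanishes_along T p x -> colex_le (rank_vector T p x) r).

(* The maximum exists and is unique for multilinear T: see LRP and is_LR_uniq. *)
Definition LR T p : {ffun 'I_d -> nat} :=
  classical_sets.xget [ffun=> 0%N] (is_LR T p).

Lemma linfun_sliceE T x i :
  multilinear T ->
  linfun (fun v : V => T (upd x i v)) =1 (fun v : V => T (upd x i v)).
Proof.
move=> hT; pose lM := GRing.isLinear.Build F V V _ _ (hT x i).
pose f : {linear V -> V} := HB.pack (fun v : V => T (upd x i v)) lM.
exact: (lfunE f).
Qed.

Lemma is_LR_uniq T p r s : is_LR T p r -> is_LR T p s -> r = s.
Proof.
move=> [[x [hx <-]] hr] [[y [hy <-]] hs]; apply: colex_le_anti.
by rewrite hs ?hr.
Qed.

Lemma is_LR_exists T p : multilinear T -> exists r, is_LR T p r.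
Proof.
move=> hT; pose n := \dim {:V}.
have bnd x i : (rank_vector T p x i < n.+1)%N.
  by rewrite ffunE ltnS dimvS // subvf.
pose rv x : {ffun 'I_d -> 'I_n.+1} := [ffun i => Ordinal (bnd x i)].
pose dec (r : {ffun 'I_d -> 'I_n.+1}) : {ffun 'I_d -> nat} := [ffun i => val (r i)].
have rvK x : dec (rv x) = rank_vector T p x by apply/ffunP=> i; rewrite !ffunE.
pose A r := boolp.asbool (exists x, vanishes_along T p x /\ rv x = r).
have A0 : A (rv 0).
  apply/boolp.asboolP; exists 0; split=> // i /andP[_ id].
  apply: (@multilinear0 _ _ _ _ _ _ (Ordinal id) hT).
  by rewrite !ffunE /= ltnn.
pose ge (a b : {ffun 'I_d -> nat}) := colex_le b a.
case: (@extremumP _ _ ge (rv 0) A dec).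
- exact: colex_le_refl.
- by move=> b a c ba cb; apply: colex_le_trans cb ba.
- by move=> a b; apply: colex_le_total.
- exact: A0.
move=> r /boolp.asboolP[x [hx <-]] hmax.
exists (rank_vector T p x); split; first by exists x.
move=> y hy; rewrite -!rvK; apply: hmax; apply/boolp.asboolP.
by exists y.
Qed.

Lemma LRP T p : multilinear T -> is_LR T p (LR T p).
Proof. by move=> hT; apply: classical_sets.xgetPex; apply: is_LR_exists. Qed.

End LocalRank.

(* Extension of scalars along iota : F -> K. The basis vbasis {:V} identifies V
   with F^n, hence V (x) K with K^n; ext_tensor is the unique K-multilinear map
   extending T (multilinear_ext_tensor, ext_tensor_ext_point,
   ext_tensor_unique). *)
Section ScalarExtension.
Variables (F K : fieldType) (iota : {rmorphism F -> K}).
Variables (V : vectType F) (d : nat).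
Implicit Types (T : {ffun 'I_d -> V} -> V) (x : {ffun 'I_d -> V}).

Definition ext_space : vectType K := 'rV[K]_(\dim {:V}).

Definition ext_vec (v : V) : ext_space :=
  \row_(k < \dim {:V}) iota (coord (vbasis {:V}) k v).

Definition ext_point (x : {ffun 'I_d -> V}) : {ffun 'I_d -> ext_space} :=
  [ffun i => ext_vec (x i)].

Definition ext_tensor (T : {ffun 'I_d -> V} -> V)
    (x : {ffun 'I_d -> ext_space}) : ext_space :=
  \sum_(f : {ffun 'I_d -> 'I_(\dim {:V})})
    (\prod_(i < d) (x i : 'rV[K]_(\dim {:V})) 0 (f i))
      *: ext_vec (T [ffun i => (vbasis {:V})`_(f i)]).

Lemma multilinear_ext_tensor T : multilinear (ext_tensor T).
Proof.
rewrite /ext_tensor; apply: multilinear_sum => f x i a u v.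
rewrite scalerA -scalerDl; congr (_ *: _).
have eq_i t : \prod_(j < d) (upd x i t j : 'rV[K]_(\dim {:V})) 0 (f j)
  = (t : 'rV[K]_(\dim {:V})) 0 (f i)
    * \prod_(j < d | j != i) (x j : 'rV[K]_(\dim {:V})) 0 (f j).
  rewrite (bigD1 i) //= ffunE eqxx; congr (_ * _).
  by apply: eq_bigr => j /negPf ji; rewrite ffunE ji.
by rewrite !eq_i !mxE mulrDl mulrA.
Qed.

Lemma ext_tensor_ext_point T x :
  multilinear T -> ext_tensor T (ext_point x) = ext_vec (T x).
Proof.
move=> hT; pose b (k : 'I_(\dim {:V})) : V := (vbasis {:V})`_k.
pose c k (v : V) := coord (vbasis {:V}) k v.
pose T' (y : {ffun 'I_d -> V}) : V :=
  \sum_(f : {ffun 'I_d -> 'I_(\dim {:V})})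
    (\prod_(i < d) c (f i) (y i)) *: T [ffun i => b (f i)].
have hT' : multilinear T'.
  apply: multilinear_sum => f y i a u v.
  rewrite scalerA -scalerDl; congr (_ *: _).
  have eq_i t : \prod_(j < d) c (f j) (upd y i t j)
    = c (f i) t * \prod_(j < d | j != i) c (f j) (y j).
    rewrite (bigD1 i) //= ffunE eqxx; congr (_ * _).
    by apply: eq_bigr => j /negPf ji; rewrite ffunE ji.
  by rewrite !eq_i /c linearP mulrDl mulrA.
have -> : T x = T' x.
  apply: (@multilinear_ext _ _ _ _ _ b) => // [v|f].
    by exists (c^~ v); apply: (coord_vbasis (memvf v)).
  rewrite /T' (bigD1 f) //= big1 => [|i _]; last first.
    by rewrite ffunE /c /b coord_free ?(basis_free (vbasisP _)) ?eqxx.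
  rewrite scale1r big1 ?addr0 // => g /eqP gf.
  suff [i gi] : exists i, g i != f i.
    rewrite (bigD1 i) //= ffunE /c /b coord_free ?(basis_free (vbasisP _)) //.
    by rewrite eq_sym (negPf gi) mul0r scale0r.
  apply/existsP; rewrite -[X in is_true X]negbK negb_exists.
  apply/negP=> /forallP h; apply: gf; apply/ffunP=> i.
  by apply/eqP/negPn.
apply/rowP=> k; rewrite /ext_tensor /T' summxE mxE linear_sum rmorph_sum.
apply: eq_bigr => f _; rewrite !mxE linearZ rmorphM rmorph_prod; congr (_ * _).
by apply: eq_bigr => i _; rewrite ffunE mxE.
Qed.

Lemma ext_tensor_unique T (S : {ffun 'I_d -> ext_space} -> ext_space) :
  multilinear T -> multilinear S ->
  (forall x, S (ext_point x) = ext_vec (T x)) -> S =1 ext_tensor T.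
Proof.
move=> hT hS eS.
pose b (k : 'I_(\dim {:V})) : ext_space := ext_vec (vbasis {:V})`_k.
have bE k : b k = delta_mx 0 k.
  apply/rowP=> j; rewrite !mxE coord_free ?(basis_free (vbasisP _)) //.
  by rewrite eq_sym; case: (_ == _); rewrite ?rmorph1 ?rmorph0.
apply: (@multilinear_ext _ _ _ _ _ b) => // [v||f].
- by exists (fun k => (v : 'rV_ _) 0 k);
     under eq_bigr do rewrite bE; apply: row_sum_delta.
- exact: multilinear_ext_tensor.
have -> : [ffun i => b (f i)] = ext_point [ffun i => (vbasis {:V})`_(f i)].
  by apply/ffunP=> i; rewrite !ffunE.
by rewrite eS ext_tensor_ext_point.
Qed.

Definition LR_stable (T : {ffun 'I_d -> V} -> V) (p : {ffun 'I_d -> V}) : Prop :=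
  LR T p = LR (ext_tensor T) (ext_point p).

End ScalarExtension.

(* K, together with iota, is an algebraic closure of F. *)
Definition is_algebraic_closure (F : fieldType) (K : closedFieldType)
    (iota : {rmorphism F -> K}) : Prop :=
  forall z : K, algebraicOver iota z.

(* Main.v *)
Require Import Defs.
From HB Require Import structures.
From mathcomp Require Import all_boot all_order all_algebra.
From mathcomp Require Import mpoly.
From mathcomp Require boolp.

Set Implicit Arguments.
Unset Strict Implicit.
Unset Printing Implicit Defensive.

Import Order.TTheory GRing.Theory.
Local Open Scope ring_scope.

(** Write r for the local rank of T at p, and let q be a point that attains it,
with q_1 = 0 (the ranks do not depend on q_1). Let
M_i(x) = T(p_1, ..., p_(i-1), -, x_(i+1), ..., x_d), so that M_i(q) has rank
r_i, and let y_i = q_i + t_i, where the entries of the t_i are independent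
variables. For i = d, ..., 1 one constructs x_i over the ring F[t] such that
x_i M_i(x) = 0, x_i = q_i at t = 0 and, up to terms of order greater than d,
y_i - x_i lies in a fixed space of dimension r_i spanned by vectors over F, with
coefficients w_i that involve only t_i, ..., t_d. The construction projects y_i
onto the kernel of M_i(x); it only needs the rank of M_i(x), which is generically
at least r_i because it is r_i at t = 0, not to exceed r_i. It does not, because
at each point of K^N where the ranks of M_(i+1)(x), ..., M_d(x) have not dropped,
(0, ..., 0, x_(i+1), ..., x_d) competes in the definition of the local rank over
K, which is r by stability; K being infinite, the polynomial identity follows
([lifts_rank_le], [lifts_step]).

The last step of the construction says that T(x_1, ..., x_d) = 0 over F[t], so
that telescoping from x to y gives
T(y) = sum_i T(y_1, ..., y_(i-1), y_i - x_i, x_(i+1), ..., x_d).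
The coefficient of a monomial with one entry of each t_l is, on the left,
the value of T on the corresponding basis vectors. On the right, the i-th term is
a sum over the r_i coefficients w_ij and, by the Leibniz rule, over the sets S
of indices whose variables w_ij absorbs. As w_ij does not involve t_l for l < i, and the
other factor does not involve t_i, only the sets S with i in S and S contained in
{i, ..., d} contribute ([coef_corr]). There are 2 ^ (d - i) of them, and each pair
(S, j) gives a tensor that is reducible along S or zero. *)

(** * Matrices of bounded rank *)

Section BoundedRank.
Variables (F : fieldType) (n r : nat) (M : 'M[F]_n).
Variables (B : 'M[F]_(r, n)) (C : 'M[F]_(n, r)).

Lemma rank_ge_of_minor : B *m M *m C \in unitmx -> (r <= \rank M)%N.
Proof.
rewrite -row_free_unit => /eqP rG; rewrite -[X in (X <= _)%N]rG.
by apply: leq_trans (mxrankM_maxl _ _) (mxrankM_maxr _ _).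
Qed.

(** If M has rank at most r and its r x r compression B M C is invertible, then the
Schur complement M - M C (B M C)^-1 B M vanishes. Multiplying by the determinant
makes this a polynomial identity. *)
Lemma schur_complement_eq0 : (\rank M <= r)%N -> B *m M *m C \in unitmx ->
  \det (B *m M *m C) *: M = M *m C *m \adj (B *m M *m C) *m (B *m M).
Proof.
move=> rM Gunit; set G := B *m M *m C in Gunit *.
have rBM : (r <= \rank (B *m M))%N.
  move: (Gunit); rewrite -row_free_unit => /eqP rG.
  by rewrite -[X in (X <= _)%N]rG mxrankM_maxl.
have /submxP[Z MZ] : (M <= B *m M)%MS.
  by rewrite -(geq_leqif (mxrank_leqif_sup (submxMl B M))) (leq_trans rM).
have MC : M *m C = Z *m G by rewrite {1}MZ /G !mulmxA.
by rewrite MC -(mulmxA Z) mul_mx_adj mul_mx_scalar -scalemxAl -MZ.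
Qed.
End BoundedRank.

Lemma rank_factor_minor (F : fieldType) n (A : 'M[F]_n) :
  exists (B : 'M_(\rank A, n)) (C : 'M_(n, \rank A)), B *m A *m C = 1%:M.
Proof.
exists (pinvmx (col_base A)), (pinvmx (row_base A)).
rewrite -[X in _ *m X *m _](mulmx_base A) mulmxA mulVpmx ?col_base_full //.
by rewrite mul1mx mulmxVp ?row_base_free.
Qed.

(** * Nonzero polynomials have nonzero values *)

Section NonVanishing.

Lemma coef_muni n (R : comNzRingType) (p : {mpoly R[n.+1]}) (m : 'X_{1..n.+1}) :
  ((muni p)`_(m ord_max))@_[multinom m (widen_ord (leqnSn n) i) | i < n] = p@_m.
Proof.
rewrite muniE coef_sum raddf_sum /= (eq_bigr (fun m' => p@_m' *+ (m' == m))); last first.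
  move=> m' _; rewrite coefZ coefXn mulr_natr raddfMn /= mcoeffZ mcoeffX.
  rewrite mulr_natr -mulrnA mulnb; congr (_ *+ nat_of_bool _).
  apply/andP/eqP=> [[/eqP eqw /eqP eql]|->]; last by rewrite !eqxx.
  apply/mnmP=> i; have [->//|/eqP ni] := eqVneq i ord_max.
  have lti : (i < n)%N.
    by rewrite ltn_neqAle -ltnS ltn_ord andbT; apply/eqP=> e; apply: ni; apply/val_inj.
  have /mnmP/(_ (Ordinal lti)) := eqw; rewrite !mnmE.
  by have -> : widen_ord (leqnSn n) (Ordinal lti) = i by apply/val_inj.
have [mp|mp] := boolP (m \in msupp p); last first.
  rewrite (memN_msupp_eq0 mp) big_seq big1 // => m' m'p.
  by case: eqP => // e; rewrite -e m'p in mp.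
rewrite (bigD1_seq m) ?msupp_uniq //= eqxx mulr1n big1 ?addr0 // => m' /negPf ->.
by rewrite mulr0n.
Qed.

Lemma meval_muni n (R : comNzRingType) (p : {mpoly R[n.+1]}) (v : 'I_n.+1 -> R) :
  p.@[v] = (map_poly (meval (v \o widen_ord (leqnSn n))) (muni p)).[v ord_max].
Proof.
rewrite muniE raddf_sum /= horner_sum mevalE; apply: eq_bigr => m _.
rewrite map_polyZ map_polyXn hornerZ hornerXn /= mevalZ mevalX.
rewrite big_ord_recr /= mulrA; congr (_ * _ * _).
by apply: eq_bigr => i _; rewrite mnmE.
Qed.

Lemma mpoly_nonroot (K : closedFieldType) n (p : {mpoly K[n]}) :
  p != 0 -> exists v, p.@[v] != 0.
Proof.
elim: n p => [|n IHn] p p0.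
  exists (fun=> 0); apply: contra p0 => /eqP pv; apply/eqP/mpolyP=> m.
  rewrite (_ : m = 0%MM); last by apply/mnmP=> - [].
  rewrite mcoeff0 -[RHS]pv mevalE.
  have [mp|mp] := boolP (0%MM \in msupp p).
    rewrite (bigD1_seq 0%MM) ?msupp_uniq //= big_ord0 mulr1 big1 ?addr0 // => m'.
    by case/eqP; apply/mnmP=> - [].
  rewrite (memN_msupp_eq0 mp) big_seq big1 // => m' m'p.
  by rewrite (_ : m' = 0%MM) in m'p; [rewrite m'p in mp | apply/mnmP=> - []].
have [m pm] : exists m, p@_m != 0.
  by exists (mlead p); rewrite -mleadc_eq0 in p0.
have [t ht] : exists t, ((muni p)`_(m ord_max)).@[t] != 0.
  apply: IHn; apply: contraNneq pm => e0.
  by rewrite -coef_muni e0 mcoeff0.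
have /closed_nonrootP[s hs] : map_poly (meval t) (muni p) != 0.
  by apply: contraNneq ht => e0; rewrite -coef_map e0 coef0.
exists (fun i => if insub (val i) is Some j then t j else s).
rewrite meval_muni /= insubF ?ltnn //.
rewrite (eq_map_poly (g := meval t)) // => q; apply: meval_eq => i /=.
by rewrite insubT ?ltn_ord // => lti; congr t; apply/val_inj.
Qed.

Lemma mmap_nonroot (F : fieldType) (K : closedFieldType)
    (iota : {rmorphism F -> K}) n (p : {mpoly F[n]}) :
  p != 0 -> exists v, mmap iota v p != 0.
Proof.
move=> p0; have [|v hv] := @mpoly_nonroot K n (map_mpoly iota p).
  apply: contra p0 => /eqP e; apply/eqP/mpolyP=> m; apply: (fmorph_inj iota).
  by rewrite -mcoeff_map_mpoly e !mcoeff0 rmorph0.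
exists v; suff <- : (map_mpoly iota p).@[v] = mmap iota v p by [].
rewrite /map_mpoly raddf_sum /=; apply: eq_bigr => m _.
by rewrite mevalM mevalC mmap1_id mevalX.
Qed.
End NonVanishing.

(** * Iterated partial derivatives *)

Section Derivatives.
Variables (F : fieldType) (N : nat) (I : finType).
Implicit Types (u : I -> 'I_N) (S A : {set I}) (a b : {mpoly F[N]}).

(** The derivative with respect to the variables u l for l in S, once for each l *)
Definition pderiv u S a : {mpoly F[N]} := mderivm (\sum_(l in S) U_(u l))%MM a.

Lemma pderiv0 u a : pderiv u set0 a = a.
Proof. by rewrite /pderiv big_set0 mderivm0m. Qed.

Lemma pderivU1 u S l a :
  l \notin S -> pderiv u (l |: S) a = pderiv u S (mderiv (u l) a).
Proof. by move=> lS; rewrite /pderiv big_setU1 //= mderivmDm mderivmU1m. Qed.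

Lemma pderivU1r u S l a :
  l \notin S -> pderiv u (l |: S) a = mderiv (u l) (pderiv u S a).
Proof.
by move=> lS; rewrite /pderiv big_setU1 //= addmC mderivmDm mderivmU1m.
Qed.

Lemma pderiv_linear u S : linear (pderiv u S).
Proof. exact: mderivm_is_linear. Qed.

HB.instance Definition _ u S :=
  GRing.isLinear.Build F {mpoly F[N]} {mpoly F[N]} _ (pderiv u S)
    (@pderiv_linear u S).

Lemma eq_pderiv u v S a : {in S, u =1 v} -> pderiv u S a = pderiv v S a.
Proof.
by move=> uv; rewrite /pderiv (eq_bigr (fun l => U_(v l)%MM)) // => l /uv ->.
Qed.

Lemma pderiv_eq0 u S l a : l \in S -> mderiv (u l) a = 0 -> pderiv u S a = 0.
Proof.
by move=> lS a0; rewrite -(setD1K lS) pderivU1 ?setD11 // a0 linear0.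
Qed.

Lemma big_powersetU1 (V : nmodType) (G : {set I} -> V) S l : l \notin S ->
  \sum_(A in powerset (l |: S)) G A
  = \sum_(A in powerset S) (G (l |: A) + G A).
Proof.
move=> lS; rewrite big_split /= (bigID (fun A : {set I} => l \in A)) /=.
congr (_ + _).
  rewrite (reindex_onto (fun A => l |: A) (fun A => A :\ l)) /=; last first.
    by move=> A /andP[_ lA]; rewrite setD1K.
  apply: eq_bigl => A; rewrite !powersetE setU11 andbT.
  apply/andP/idP=> [[sA /eqP eA]|sA].
    rewrite -eA; apply/subsetP=> j; rewrite in_setD1 => /andP[jl].
    by move=> /(subsetP sA); rewrite !inE (negPf jl).
  rewrite setUS // setU1K //; by apply: contra lS => /(subsetP sA).
apply: eq_bigl => A; rewrite !powersetE; apply/andP/idP=> [[sA lA]|sA].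
  apply/subsetP=> j jA; have := subsetP sA j jA; rewrite !inE.
  by case: eqP jA lA => // -> ->.
split; first by rewrite subsetU // sA orbT.
by apply: contra lS => /(subsetP sA).
Qed.

Lemma finset_ind (P : {set I} -> Prop) :
  P set0 -> (forall l S, l \notin S -> P S -> P (l |: S)) -> forall S, P S.
Proof.
move=> P0 PU S; have [m] := ubnP #|S|; elim: m S => // m IHm S.
have [->//|/set0Pn[l lS]] := eqVneq S set0.
rewrite (cardsD1 l) lS ltnS -[in P S](setD1K lS) => Sm.
by apply: PU; [rewrite setD11 | apply: IHm].
Qed.

Lemma pderivM u S a b : pderiv u S (a * b)
  = \sum_(A in powerset S) pderiv u A a * pderiv u (S :\: A) b.
Proof.
elim/finset_ind: S a b => [|l S lS IHS] a b.
  by rewrite powerset0 big_set1 setD0 !pderiv0.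
rewrite pderivU1 // mderivM linearD /= !IHS -big_split big_powersetU1 //=.
apply: eq_bigr => A; rewrite powersetE => sA.
have lA : l \notin A by apply: contra lS => /(subsetP sA).
rewrite pderivU1 //; congr (_ * _ + _ * _).
  congr pderiv; apply/setP=> j; rewrite !inE negb_or.
  by case: eqP => [->|_] //=; rewrite (negPf lS) andbF.
have -> : (l |: S) :\: A = l |: (S :\: A).
  apply/setP=> j; rewrite !inE; case: eqP => [->|_] //=.
  by rewrite lA.
by rewrite pderivU1 // inE (negPf lS) andbF.
Qed.

Lemma pderiv_expM_eq0 u S (t : 'I_N -> F) a b k :
  a.@[t] = 0 -> (#|S| < k)%N -> (pderiv u S (a ^+ k * b)).@[t] = 0.
Proof.
move=> a0; elim/finset_ind: S k b => [|l S lS IHS] k b.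
  by case: k => // k _; rewrite pderiv0 exprS -mulrA mevalM a0 mul0r.
rewrite cardsU1 lS add1n; case: k => // k; rewrite ltnS => Sk.
rewrite pderivU1 //.
have [c ->] : exists c, mderiv (u l) (a ^+ k.+1 * b) = a ^+ k * c.
  elim: k {Sk} => [|k [c IHk]]; first by eexists; rewrite mul1r.
  exists (mderiv (u l) a * b + c).
  rewrite exprS -mulrA mderivM IHk mulrDr; congr (_ + _).
    by rewrite mulrCA.
  by rewrite mulrA -exprS.
exact: IHS.
Qed.

End Derivatives.

(** * Polynomials that do not involve given variables *)

Section FreeOf.
Variables (F : fieldType) (N : nat) (X : pred 'I_N).

(** Polynomials whose derivative with respect to every variable in X is 0. In positive
characteristic they may still involve p-th powers of these variables, which is
harmless: only the derivatives are used. *)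
Definition free_of : {pred {mpoly F[N]}} :=
  [pred a | [forall v, X v ==> (mderiv v a == 0)]].

Lemma free_ofP a : reflect (forall v, X v -> mderiv v a = 0) (a \in free_of).
Proof.
apply: (iffP forallP) => [h v Xv|h v]; first exact/eqP/(implyP (h v)).
by apply/implyP=> /h ->.
Qed.

Lemma free_of_subring : subring_closed free_of.
Proof.
split=> [|a b /free_ofP ha /free_ofP hb|a b /free_ofP ha /free_ofP hb];
  apply/free_ofP=> v Xv.
- by rewrite -mpolyC1 mderivC.
- by rewrite mderivB ha // hb // subr0.
- by rewrite mderivM ha // hb // mul0r mulr0 addr0.
Qed.

HB.instance Definition _ :=
  GRing.isSubringClosed.Build {mpoly F[N]} free_of free_of_subring.

Lemma free_ofC c : c%:MP \in free_of.
Proof. by apply/free_ofP=> v _; rewrite mderivC. Qed.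

Lemma mxOver_free_ofC m n (A : 'M[F]_(m, n)) :
  map_mx (@mpolyC N F) A \is a mxOver free_of.
Proof. by apply/mxOverP=> i j; rewrite mxE free_ofC. Qed.

End FreeOf.

Section MxOverSubring.
Variables (R : comNzRingType) (S : subringClosed R).

Lemma det_mxOver n (A : 'M[R]_n) : A \is a mxOver S -> \det A \in S.
Proof.
move/mxOverP=> SA; apply: rpred_sum => s _; rewrite rpredMsign.
by apply: rpred_prod => i _.
Qed.

Lemma adjugate_mxOver n (A : 'M[R]_n) :
  A \is a mxOver S -> \adj A \is a mxOver S.
Proof.
move/mxOverP=> SA; apply/mxOverP=> i j; rewrite mxE rpredMsign.
by apply: det_mxOver; apply/mxOverP=> k l; rewrite !mxE.
Qed.

End MxOverSubring.

(** * Extension of a tensor to commutative rings *)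

Section Tensor.
Variables (F : fieldType) (d n : nat).
(* The tensor is given by its values tau f on the tuples of basis vectors. *)
Variable tau : {ffun 'I_d -> 'I_n} -> 'rV[F]_n.

(** The operations [upd], [hyb] and the map of a point, for row vectors over an
arbitrary type instead of a field *)
Definition rupd (R : Type) (x : {ffun 'I_d -> 'rV[R]_n}) (i : 'I_d) v :
  {ffun 'I_d -> 'rV[R]_n} := [ffun j => if j == i then v else x j].

Definition rhyb (R : Type) (p : {ffun 'I_d -> 'rV[R]_n}) (i : nat)
    (x : {ffun 'I_d -> 'rV[R]_n}) : {ffun 'I_d -> 'rV[R]_n} :=
  [ffun j : 'I_d => if (j < i)%N then p j else x j].

Definition rmap (R R' : Type) (f : R -> R') (x : {ffun 'I_d -> 'rV[R]_n}) :
  {ffun 'I_d -> 'rV[R']_n} := [ffun j => map_mx f (x j)].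

Section Eval.
Variables (R : comNzRingType) (phi : {rmorphism F -> R}).
Implicit Types (x : {ffun 'I_d -> 'rV[R]_n}) (i : 'I_d).

Definition tmonomial x (f : {ffun 'I_d -> 'I_n}) : R := \prod_(i < d) x i 0 (f i).

(** The multilinear map over R that extends the tensor tau *)
Definition teval x : 'rV[R]_n :=
  \sum_(f : {ffun 'I_d -> 'I_n})
     tmonomial x f *: map_mx phi (tau f).

(** The matrix, acting on row vectors, of the tensor as a function of the i-th
argument alone: see [teval_rupd] and [teval_slice]. *)
Definition tslice x i : 'M[R]_n :=
  \matrix_(k < n) teval (rupd x i (delta_mx 0 k)).

Lemma teval_rupd x i v : teval (rupd x i v) = v *m tslice x i.
Proof.
have prodE u f : tmonomial (rupd x i u) f
    = u 0 (f i) * \prod_(j < d | j != i) x j 0 (f j).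
  rewrite /tmonomial (bigD1 i) //= ffunE eqxx; congr (_ * _).
  by apply: eq_bigr => j /negPf ji; rewrite ffunE ji.
rewrite mulmx_sum_row; under [RHS]eq_bigr do rewrite rowK /teval scaler_sumr.
rewrite exchange_big /teval; apply: eq_bigr => f _ /=.
rewrite prodE [RHS](bigD1 (f i)) //= [X in _ = _ + X]big1 => [|k kf]; last first.
  by rewrite prodE mxE eqxx eq_sym (negPf kf) mul0r scale0r scaler0.
by rewrite prodE mxE !eqxx mul1r addr0 scalerA.
Qed.

Lemma teval_eq0 x i : x i = 0 -> teval x = 0.
Proof.
move=> xi; rewrite /teval big1 // => f _.
by rewrite /tmonomial (bigD1 i) //= xi mxE mul0r scale0r.
Qed.

Lemma eq_tslice x x' i : (forall j, j != i -> x j = x' j) -> tslice x i = tslice x' i.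
Proof.
move=> xx'; apply/row_matrixP=> k; rewrite !rowK; congr teval.
by apply/ffunP=> j; rewrite !ffunE; case: eqP => // /eqP /xx'.
Qed.

Lemma teval_slice x i : teval x = x i *m tslice x i.
Proof.
rewrite -teval_rupd; congr teval; apply/ffunP=> j; rewrite ffunE.
by case: eqP => [->|].
Qed.

Lemma teval_mxOver (S : subringClosed R) x : (forall c, phi c \in S) ->
  (forall j, x j \is a mxOver S) -> teval x \is a mxOver S.
Proof.
move=> SC Sx; apply/mxOverP=> a b; rewrite summxE; apply: rpred_sum => f _.
rewrite !mxE rpredM //; apply: rpred_prod => j _; exact: (mxOverP (Sx j)).
Qed.

Lemma tslice_mxOver (S : subringClosed R) x i : (forall c, phi c \in S) ->
  (forall j, j != i -> x j \is a mxOver S) -> tslice x i \is a mxOver S.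
Proof.
move=> SC Sx; apply/mxOverP=> a b; rewrite mxE.
apply: (mxOverP (teval_mxOver SC _)) => j; rewrite ffunE.
case: eqP => [_|/eqP/Sx //]; apply/mxOverP=> u v; rewrite mxE.
by case: (_ && _); rewrite ?rpred1 ?rpred0.
Qed.

End Eval.

Section Base.
Variables (R R' : comNzRingType) (phi : {rmorphism F -> R}).
Variables (phi' : {rmorphism F -> R'}) (psi : {rmorphism R -> R'}).
Hypothesis phiE : forall c, psi (phi c) = phi' c.

Lemma map_teval x : map_mx psi (teval phi x) = teval phi' (rmap psi x).
Proof.
apply/rowP=> k; rewrite !mxE !summxE rmorph_sum; apply: eq_bigr => f _.
rewrite !mxE rmorphM rmorph_prod phiE; congr (_ * _).
by apply: eq_bigr => i _; rewrite ffunE mxE.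
Qed.

Lemma map_tslice x i : map_mx psi (tslice phi x i) = tslice phi' (rmap psi x) i.
Proof.
apply/row_matrixP=> k; rewrite -map_row !rowK map_teval; congr teval.
apply/ffunP=> j; rewrite !ffunE; case: eqP => // _.
by rewrite map_delta_mx.
Qed.

End Base.
End Tensor.

(** * Lifting the maximal point to polynomials *)

Section Lift.
Variables (F : fieldType) (K : closedFieldType) (iota : {rmorphism F -> K}).
Variables (d n : nat) (tau : {ffun 'I_d -> 'I_n} -> 'rV[F]_n).
Variables (p q : {ffun 'I_d -> 'rV[F]_n}).

Local Notation idF := (idfun : {rmorphism F -> F}).
Local Notation N := #|{: 'I_d * 'I_n}|.
Local Notation R := {mpoly F[N]}.
Local Notation cst := (@mpolyC N F : {rmorphism F -> R}).
Local Notation ev0 := (meval (fun=> 0) : {rmorphism R -> F}).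
Local Notation pR := (rmap cst p).
Local Notation pK := (rmap iota p).

(** The matrix M_l(q) and its rank *)
Definition pslice (l : 'I_d) : 'M[F]_n := tslice tau idF (rhyb p l.+1 q) l.

Definition prank (l : 'I_d) : nat := \rank (pslice l).

(* The case j = 0 can be imposed by taking q 0 = 0. *)
Hypothesis q_vanishes :
  forall j : 'I_d, teval tau idF (rhyb p j q) = 0.

(* Maximality of the ranks at q among the admissible points over K *)
Hypothesis prank_max : forall x : {ffun 'I_d -> 'rV[K]_n},
  (forall j : nat, (0 < j < d)%N -> teval tau iota (rhyb pK j x) = 0) ->
  colex_le [ffun l : 'I_d => \rank (tslice tau iota (rhyb pK l.+1 x) l)]
           [ffun l => prank l].

(** The variable in coordinate k of the l-th vector *)
Definition tvar (l : 'I_d) (k : 'I_n) : 'I_N := enum_rank (l, k).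

(** The variables that belong to a vector of index less than l *)
Definition below (l : nat) : pred 'I_N := [pred v : 'I_N | ((enum_val v).1 : 'I_d) < l]%N.

(** The generic vector y_l = q_l + t_l *)
Definition ypt (l : 'I_d) : 'rV[R]_n :=
  \row_k ((q l 0 k)%:MP + 'X_(tvar l k)).

(** The state of the construction when x_l is known for l >= k, the other x_l being
set to 0. The last two fields say that the ranks of the slices are generically at
least those at q, and that y_l - x_l lies in a space of dimension [prank l]
spanned by vectors over F, up to a multiple of h ^+ d.+1 with h = 0 at the origin,
which has no nonzero derivatives of order at most d there. *)
Record lifts (k : nat) (x : {ffun 'I_d -> 'rV[R]_n}) : Prop := Lifts {
  lifts_vanish : forall j, (k <= j < d)%N -> teval tau cst (rhyb pR j x) = 0;
  lifts_0 : forall l : 'I_d, (l < k)%N -> x l = 0;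
  lifts_ev0 : forall l : 'I_d, (k <= l)%N -> map_mx ev0 (x l) = q l;
  lifts_free : forall l : 'I_d, (k <= l)%N ->
    x l \is a mxOver (free_of (below l));
  lifts_rank : exists2 delta : R, delta != 0 & forall t,
    mmap iota t delta != 0 -> forall l : 'I_d, (k <= l)%N ->
    (prank l <= \rank (map_mx (mmap iota t) (tslice tau cst (rhyb pR l.+1 x) l)))%N;
  lifts_corr : forall l : 'I_d, (k <= l)%N ->
    exists (w : 'rV[R]_(prank l)) (B : 'M[F]_(prank l, n)) (h : R),
      [/\ w \is a mxOver (free_of (below l)), ev0 h = 0 &
          ypt l - x l = w *m map_mx cst B + h ^+ d.+1 *: ypt l] }.

Lemma ypt_free l : ypt l \is a mxOver (free_of (below l)).
Proof.
apply/mxOverP=> a b; rewrite mxE rpredD ?free_ofC //.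
apply/free_ofP=> v vl; rewrite mderivX mnm1E.
case: eqP => [e|_]; last by rewrite scale0r.
by move: vl; rewrite -e /below /tvar /= enum_rankK ltnn.
Qed.

Lemma free_below k l m1 m2 (A : 'M[R]_(m1, m2)) : (k <= l)%N ->
  A \is a mxOver (free_of (below l)) -> A \is a mxOver (free_of (below k)).
Proof.
move=> kl; apply: mxOverS => a /free_ofP ha; apply/free_ofP => v vk.
by apply: ha; apply: leq_trans kl.
Qed.

Lemma ypt_ev0 l : map_mx ev0 (ypt l) = q l.
Proof. by apply/rowP=> k; rewrite !mxE /= mevalD mevalC mevalXU addr0. Qed.

Lemma rmap_rhyb (S S' : Type) (f : S -> S') (z x : {ffun 'I_d -> 'rV[S]_n}) j :
  rmap f (rhyb z j x) = rhyb (rmap f z) j (rmap f x).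
Proof. by apply/ffunP=> l; rewrite !ffunE; case: ifP. Qed.

Lemma cst_mmap t c : (mmap iota t : {rmorphism R -> K}) (cst c) = iota c.
Proof. exact: mmapC. Qed.

Lemma cst_ev0 c : ev0 (cst c) = idF c.
Proof. exact: mevalC. Qed.

Lemma map_slice_eval t j x l :
  map_mx (mmap iota t) (tslice tau cst (rhyb pR j x) l)
  = tslice tau iota (rhyb pK j (rmap (mmap iota t) x)) l.
Proof.
rewrite (map_tslice _ (cst_mmap t)).
rewrite rmap_rhyb; congr (tslice _ _ (rhyb _ _ _) _).
by apply/ffunP=> m; apply/rowP=> k; rewrite !ffunE !mxE; apply: cst_mmap.
Qed.

(** Where the ranks of the later slices have not dropped, maximality in the
colexicographic order bounds the rank of the i-th slice. *)
Lemma lifts_rank_le x (i : 'I_d) (t : 'I_N -> K) :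
  lifts i.+1 x ->
  (forall l : 'I_d, (i < l)%N ->
    (prank l <= \rank (map_mx (mmap iota t) (tslice tau cst (rhyb pR l.+1 x) l)))%N) ->
  (\rank (map_mx (mmap iota t) (tslice tau cst (rhyb pR i.+1 x) i)) <= prank i)%N.
Proof.
move=> Lx rk; rewrite map_slice_eval.
have /prank_max : forall j, (0 < j < d)%N ->
    teval tau iota (rhyb pK j (rmap (mmap iota t) x)) = 0.
  move=> j /andP[_ jd]; have [ij|ji] := ltnP i j.
    have jr : (i < j < d)%N by rewrite ij jd.
    have := congr1 (map_mx (mmap iota t)) (lifts_vanish Lx jr).
    rewrite (map_teval _ (cst_mmap t)).
    rewrite map_mx0 rmap_rhyb => e; rewrite -[RHS]e; congr (teval _ _ (rhyb _ _ _)).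
    by apply/ffunP=> m; apply/rowP=> k; rewrite !ffunE !mxE; apply/esym/cst_mmap.
  apply: (@teval_eq0 _ _ _ _ _ _ _ (Ordinal jd)).
  by rewrite !ffunE /= ltnn (lifts_0 Lx) // map_mx0.
case/orP=> [/eqP/ffunP/(_ i)|/existsP[l /andP[lt_l /forallP eq_l]]].
  by rewrite !ffunE => ->.
move: lt_l; rewrite !ffunE; case: (ltngtP l i) => [li _|il|/val_inj->]; last exact: ltnW.
  by have := implyP (eq_l i) li; rewrite !ffunE => /eqP->.
by rewrite ltnNge -map_slice_eval rk.
Qed.

Lemma lifts_step (i : 'I_d) x : lifts i.+1 x -> exists x', lifts i x'.
Proof.
move=> Lx; pose M := tslice tau cst (rhyb pR i.+1 x) i.
have [B [C BC]] := rank_factor_minor (pslice i).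
pose BR := map_mx cst B; pose CR := map_mx cst C.
pose G := BR *m M *m CR; pose dl := \det G.
(* ep is the inverse of dl = \det G up to order d, since dl = 1 at the origin; it
   replaces division by dl, which is not available over polynomials. *)
pose ep := \sum_(k < d.+1) (1 - dl) ^+ k.
pose w := ep *: (ypt i *m M *m CR *m \adj G).
pose xi := (ep * dl) *: ypt i - w *m BR.
have M0 : map_mx ev0 M = pslice i.
  rewrite (map_tslice _ cst_ev0).
  apply: eq_tslice => j ji; rewrite rmap_rhyb !ffunE.
  case: ltnP => [_|ij]; first by apply/rowP=> k; rewrite !mxE; apply: cst_ev0.
  by rewrite (lifts_ev0 Lx).
have cst0 m1 m2 (A : 'M[F]_(m1, m2)) : map_mx ev0 (map_mx cst A) = A.
  by apply/matrixP=> a b; rewrite !mxE; apply: cst_ev0.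
have G0 : map_mx ev0 G = 1%:M.
  by rewrite !map_mxM M0 !cst0.
have dl0 : ev0 dl = 1 by rewrite -det_map_mx G0 det1.
have epdl : ep * dl = 1 - (1 - dl) ^+ d.+1.
  rewrite -[RHS]opprB subrX1 -/ep mulrC -mulNr; congr (_ * _).
  by rewrite opprB opprB addrC subrK.
have dl_neq0 : dl != 0 by apply: contra_eq_neq dl0 => ->; rewrite rmorph0 eq_sym oner_eq0.
have [dt dt_neq0 dtP] := lifts_rank Lx.
have GE t : map_mx (mmap iota t) G
    = map_mx iota B *m map_mx (mmap iota t) M *m map_mx iota C.
  rewrite !map_mxM; congr (_ *m _ *m _); apply/matrixP=> a b;
  rewrite !mxE; exact: cst_mmap.
have Gunit t : mmap iota t dl != 0 -> map_mx (mmap iota t) G \in unitmx.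
  by rewrite unitmxE det_map_mx unitfE.
(* The identity holds at all points over K where dt and dl do not vanish, hence
   over polynomials. *)
have ME : dl *: M = M *m CR *m \adj G *m (BR *m M).
  apply/matrixP=> a b; apply/eqP; rewrite -subr_eq0; apply: contraT => E0.
  have [|t] := @mmap_nonroot _ _ iota _
    (dt * dl * ((dl *: M) a b - (M *m CR *m \adj G *m (BR *m M)) a b)).
    by rewrite !mulf_neq0.
  rewrite !rmorphM /= !mulf_eq0 !negb_or => /andP[/andP[dtt dlt]] /negP[].
  rewrite rmorphB subr_eq0 /=.
  have rM := lifts_rank_le Lx (fun l => dtP t dtt l).
  have := @schur_complement_eq0 _ _ _ _ (map_mx iota B) (map_mx iota C) rM.
  rewrite -/M -GE => /(_ (Gunit t dlt)).
  move/matrixP/(_ a b); rewrite det_map_mx.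
  have cE m1 m2 (A : 'M[F]_(m1, m2)) :
      map_mx iota A = map_mx (mmap iota t) (map_mx cst A).
    by apply/matrixP=> u v; rewrite !mxE; apply/esym/cst_mmap.
  rewrite !cE -map_mx_adj -!map_mxM -map_mxZ !mxE => ->.
  by rewrite eqxx.
have xiM : xi *m M = 0.
  rewrite mulmxBl -scalemxAl -scalerA -!scalemxAl -scalerBr scalemxAr ME.
  by rewrite -!mulmxA subrr scaler0.
have freeM : M \is a mxOver (free_of (below i)).
  apply: tslice_mxOver => [c|j ji]; first exact: free_ofC.
  rewrite ffunE; case: ltnP => [_|ij]; first by rewrite ffunE mxOver_free_ofC.
  exact: free_below (ltnW ij) (lifts_free Lx ij).
have freeG : G \is a mxOver (free_of (below i)).
  by rewrite !mxOverM ?mxOver_free_ofC.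
have freedl : dl \in free_of (below i) by exact: det_mxOver.
have freeep : ep \in free_of (below i).
  by apply: rpred_sum => k _; rewrite rpredX ?rpredB ?rpred1.
have freew : w \is a mxOver (free_of (below i)).
  apply: mxOverZ => //; apply: mxOverM; last exact: adjugate_mxOver.
  apply: mxOverM; last exact: mxOver_free_ofC.
  by apply: mxOverM => //; apply: ypt_free.
have w0 : map_mx ev0 w = 0.
  rewrite map_mxZ !map_mxM ypt_ev0 M0.
  suff -> : q i *m pslice i = 0 by rewrite !mul0mx scaler0.
  rewrite -[RHS](q_vanishes i) (teval_slice _ _ _ i) ffunE ltnn; congr (_ *m _).
  by apply: eq_tslice => j ji; rewrite !ffunE ltnS leq_eqVlt val_eqE (negPf ji).
have hybE j : (i < j)%N -> rhyb pR j (rupd x i xi) = rhyb pR j x.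
  move=> ij; apply/ffunP=> l; rewrite !ffunE; case: ltnP => // jl.
  by case: eqP => // li; rewrite li leqNgt ij in jl.
exists (rupd x i xi); split=> [j|l li|l|l||l].
- rewrite leq_eqVlt => /andP[/predU1P[<-|ij] jd]; last first.
    by rewrite hybE // (lifts_vanish Lx) // ij.
  have xiE : rhyb pR i (rupd x i xi) i = xi by rewrite !ffunE ltnn eqxx.
  have sliceE : tslice tau cst (rhyb pR i (rupd x i xi)) i = M.
    apply: eq_tslice => l /negPf li; rewrite !ffunE li ltnS [in RHS]leq_eqVlt.
    by rewrite val_eqE li.
  by rewrite (teval_slice tau cst _ i) xiE sliceE.
- by rewrite ffunE -val_eqE ltn_eqF // (lifts_0 Lx) // ltnW.
- rewrite ffunE; case: eqP => [-> _|/eqP li]; last first.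
    by rewrite leq_eqVlt val_eqE eq_sym (negPf li); apply: (lifts_ev0 Lx).
  rewrite map_mxB map_mxM w0 mul0mx subr0 map_mxZ ypt_ev0 epdl.
  by rewrite rmorphB rmorphXn rmorphB !rmorph1 dl0 subrr expr0n subr0 scale1r.
- rewrite ffunE; case: eqP => [-> _|/eqP li]; last first.
    by rewrite leq_eqVlt val_eqE eq_sym (negPf li); apply: (lifts_free Lx).
  by rewrite rpredB ?mxOverZ ?mxOverM ?mxOver_free_ofC ?ypt_free ?rpredM.
- exists (dt * dl) => [|t]; first exact: mulf_neq0.
  rewrite rmorphM mulf_eq0 negb_or => /andP[dtt dlt] l il.
  rewrite hybE //; move: il; rewrite leq_eqVlt => /predU1P[/val_inj<-|il].
    apply: (@rank_ge_of_minor _ _ _ _ (map_mx iota B) (map_mx iota C)).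
    by rewrite -GE; apply: Gunit.
  exact: dtP.
- rewrite ffunE; case: eqP => [-> _|/eqP li]; last first.
    by rewrite leq_eqVlt val_eqE eq_sym (negPf li); apply: (lifts_corr Lx).
  exists w, B, (1 - dl); split=> //; first by rewrite rmorphB rmorph1 dl0 subrr.
  rewrite /xi epdl scalerBl scale1r -addrA -opprD subKr.
  exact: addrC.
Qed.

Lemma lifts_exists : exists x, lifts 0 x.
Proof.
suff H k : (k <= d)%N -> exists x, lifts (d - k) x.
  by have := H d (leqnn d); rewrite subnn.
elim: k => [|k IHk] kd; last first.
  have [x Lx] := IHk (ltnW kd).
  have kd' : (d - k.+1 < d)%N by rewrite ltn_subrL (leq_ltn_trans _ kd).
  by apply: (@lifts_step (Ordinal kd') x); rewrite /= subnSK.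
have noI (l : 'I_d) : (d - 0 <= l)%N = false by rewrite subn0 leqNgt ltn_ord.
exists 0; split=> [j|l _|l|l||l]; rewrite ?noI //.
- by rewrite subn0; case: leqP.
- by rewrite ffunE.
- by exists 1; [exact: oner_neq0 | move=> t _ l; rewrite noI].
Qed.

(** ** Extraction of multilinear coefficients *)

(** The selection, in each vector, of the variable given by f *)
Definition tdir (f : {ffun 'I_d -> 'I_n}) (l : 'I_d) : 'I_N := tvar l (f l).

(** The derivative at the origin along the variables selected by f in the vectors
of S *)
Definition coef f (S : {set 'I_d}) (a : R) : F := ev0 (pderiv (tdir f) S a).

Lemma eq_coef (f g : {ffun 'I_d -> 'I_n}) (S : {set 'I_d}) a :
  {in S, f =1 g} -> coef f S a = coef g S a.
Proof.
move=> fg; rewrite /coef (@eq_pderiv _ _ _ _ (tdir g)) // => l /fg.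
by rewrite /tdir => ->.
Qed.

Lemma coefD f S : {morph coef f S : a b / a + b}.
Proof. by move=> a b; rewrite /coef linearD rmorphD. Qed.

Lemma coefZ f S c a : coef f S (cst c * a) = c * coef f S a.
Proof. by rewrite /= mul_mpolyC /coef linearZ /= mevalZ. Qed.

Lemma coef_sum f S (J : Type) (s : seq J) (P : pred J) (a : J -> R) :
  coef f S (\sum_(j <- s | P j) a j) = \sum_(j <- s | P j) coef f S (a j).
Proof. by rewrite /coef linear_sum rmorph_sum. Qed.

Lemma coefM f a b :
  coef f setT (a * b) = \sum_(S : {set 'I_d}) coef f S a * coef f (~: S) b.
Proof.
rewrite /coef pderivM rmorph_sum /= (eq_bigl predT) => [|S]; last first.
  by rewrite powersetE subsetT.
by apply: eq_bigr => S _; rewrite rmorphM setTD.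
Qed.

Lemma tvar_inj l k l' k' : tvar l k = tvar l' k' -> l = l' /\ k = k'.
Proof. by move/enum_rank_inj => -[-> ->]. Qed.

(** The generic point (y_0, ..., y_(d-1)) *)
Definition yvec : {ffun 'I_d -> 'rV[R]_n} := [ffun l => ypt l].

(** The variables that belong to the l-th vector *)
Definition dir (l : 'I_d) : pred 'I_N := [pred v : 'I_N | (enum_val v).1 == l].

Lemma ypt_free_dir l m : m != l -> ypt m \is a mxOver (free_of (dir l)).
Proof.
move=> ml; apply/mxOverP=> a b; rewrite mxE rpredD ?free_ofC //.
apply/free_ofP=> v vl; rewrite mderivX mnm1E.
case: eqP => [e|_]; last by rewrite scale0r.
by move: vl; rewrite -e /dir /tvar /= enum_rankK (negPf ml).
Qed.

Lemma mderiv_ypt l k k' : mderiv (tvar l k) (ypt l 0 k') = (k' == k)%:R.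
Proof.
rewrite mxE mderivD mderivC add0r mderivX mnm1E.
have -> : (tvar l k' == tvar l k) = (k' == k).
  by apply/eqP/eqP=> [/tvar_inj[]//|->].
case: eqP => [->|_]; last by rewrite scale0r.
by rewrite scale1r -[X in (X - _)%MM]add0m addmK mpolyX0.
Qed.

Lemma coef_tmonomial_y f h : coef f setT (tmonomial yvec h) = (h == f)%:R.
Proof.
pose c (S : {set 'I_d}) : R := \prod_(l in S) (h l == f l)%:R.
have H S : pderiv (tdir f) S (tmonomial yvec h)
    = c S * \prod_(l in ~: S) ypt l 0 (h l).
  elim/finset_ind: S => [|l S lS IHS].
    rewrite pderiv0 /c big_set0 mul1r setC0 /tmonomial.
    by apply: eq_big => l; rewrite ?inE // ffunE.
  have dC : mderiv (tdir f l) (c S) = 0.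
    suff : c S \in free_of (pred1 (tdir f l)).
      by move/free_ofP; apply; rewrite /= eqxx.
    by apply: rpred_prod => m _; apply: rpred_nat.
  have dP : mderiv (tdir f l) (\prod_(m in (~: S) :\ l) ypt m 0 (h m)) = 0.
    suff : (\prod_(m in (~: S) :\ l) ypt m 0 (h m)) \in free_of (dir l).
      by move/free_ofP; apply; rewrite /dir /= enum_rankK.
    apply: rpred_prod => m; rewrite !inE => /andP[ml _].
    exact: (mxOverP (ypt_free_dir ml)).
  have -> : c (l |: S) = (h l == f l)%:R * c S by rewrite /c big_setU1.
  rewrite pderivU1r // IHS (big_setD1 l) ?inE //=.
  rewrite mderivM dC mul0r add0r mderivM dP mulr0 addr0 mderiv_ypt mulrCA mulrA.
  by congr (_ * _); apply: eq_bigl => m; rewrite !inE negb_or.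
rewrite /coef H setCT big_set0 mulr1 /c rmorph_prod /=.
rewrite (eq_bigr (fun l => (h l == f l)%:R)) => [|l _]; last exact: rmorph_nat.
have [->|hf] := eqVneq h f; first by rewrite big1 // => l _; rewrite eqxx.
have /existsP[l hl] : [exists l, h l != f l].
  apply: contraR hf; rewrite negb_exists => /forallP e.
  by apply/eqP/ffunP=> l; apply/eqP/negPn.
by rewrite (bigD1 l) ?inE //= (negPf hl) mul0r.
Qed.

Lemma coef_teval_y f k : coef f setT (teval tau cst yvec 0 k) = tau f 0 k.
Proof.
have E h : coef f setT ((tmonomial yvec h *: map_mx cst (tau h)) 0 k)
    = tau h 0 k * (h == f)%:R.
  by rewrite !mxE mulrC coefZ coef_tmonomial_y.
rewrite summxE coef_sum (eq_bigr _ (fun h _ => E h)).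
rewrite (bigD1 f) //= eqxx mulr1 big1 ?addr0 // => h /negPf ->.
by rewrite mulr0.
Qed.

(** The slice at l of the point (y_0, ..., y_(l-1), x_l, ..., x_(d-1)) *)
Definition mslice (x : {ffun 'I_d -> 'rV[R]_n}) (l : 'I_d) : 'M[R]_n :=
  tslice tau cst (rhyb yvec l x) l.

(** The l-th term of the telescoping sum *)
Definition corr (x : {ffun 'I_d -> 'rV[R]_n}) l : 'rV[R]_n := (ypt l - x l) *m mslice x l.

Lemma teval_telescope x :
  teval tau cst yvec = teval tau cst x + \sum_l corr x l.
Proof.
have := telescope_sumr (fun l => teval tau cst (rhyb yvec l x)) (leq0n d).
have -> : rhyb yvec d x = yvec by apply/ffunP=> l; rewrite !ffunE ltn_ord.
have -> : rhyb yvec 0 x = x by apply/ffunP=> l; rewrite !ffunE.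
move/esym/eqP; rewrite subr_eq addrC => /eqP->; congr (_ + _).
rewrite big_mkord; apply: eq_bigr => l _.
have y1 : rhyb yvec l.+1 x l = ypt l by rewrite !ffunE ltnS leqnn.
have y0 : rhyb yvec l x l = x l by rewrite ffunE ltnn.
have yS : tslice tau cst (rhyb yvec l.+1 x) l = mslice x l.
  by apply: eq_tslice => m ml; rewrite !ffunE ltnS leq_eqVlt val_eqE (negPf ml).
rewrite (teval_slice _ _ (rhyb yvec l x) l) (teval_slice _ _ (rhyb yvec l.+1 x) l).
by rewrite y1 y0 yS -/(mslice x l) -mulmxBl.
Qed.

(** The sets that contain l and no smaller element *)
Definition upsets (l : 'I_d) : {set {set 'I_d}} :=
  [set l |: A | A in powerset [set m : 'I_d | (l < m)%N]].

Lemma card_upsets l : #|upsets l| = (2 ^ (d - l.+1))%N.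
Proof.
rewrite card_in_imset => [|A A']; last first.
  rewrite !powersetE => sA sA' e.
  have lN (X : {set 'I_d}) : X \subset [set m : 'I_d | (l < m)%N] -> l \notin X.
    by move=> sX; apply/negP=> /(subsetP sX); rewrite inE ltnn.
  by rewrite -(setU1K (lN A sA)) e setU1K // lN.
rewrite card_powerset; congr (2 ^ _)%N.
rewrite cardsE -sum1_card -[RHS]muln1 -(sum_nat_const_nat l.+1 d 1).
by rewrite (big_geq_mkord l.+1 d xpredT (fun=> 1%N)).
Qed.

(** Leibniz rule for the l-th term: w has no variables below l, so S meets only
indices >= l; E has no variable of index l, so l belongs to S. *)
Lemma coef_corr x l : lifts 0 x ->
  exists (w : 'rV[R]_(prank l)) (E : 'M[R]_(prank l, n)), forall f k,
    coef f setT (corr x l 0 k)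
    = \sum_(S in upsets l) \sum_(j < prank l) coef f S (w 0 j) * coef f (~: S) (E j k).
Proof.
move=> Lx; have [w [B [h [freew h0 corrE]]]] := lifts_corr Lx (leq0n l).
have freeM : mslice x l \is a mxOver (free_of (dir l)).
  apply: tslice_mxOver => [c|j jl]; first exact: free_ofC.
  rewrite ffunE; case: ltnP => [_|lj]; first by rewrite ffunE ypt_free_dir.
  apply: mxOverS (lifts_free Lx (leq0n j)) => a /free_ofP ha.
  apply/free_ofP => v /eqP vl; apply: ha; rewrite /below /= vl.
  by rewrite ltn_neqAle eq_sym val_eqE jl.
exists w, (map_mx cst B *m mslice x l) => f k.
have freeE : map_mx cst B *m mslice x l \is a mxOver (free_of (dir l)).
  by apply: mxOverM; first exact: mxOver_free_ofC.
rewrite /corr corrE mulmxDl -mulmxA -scalemxAl.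
move: (ypt l *m mslice x l) (map_mx cst B *m mslice x l) freeE => X E freeE.
rewrite !mxE coefD.
have -> : coef f setT (h ^+ d.+1 * X 0 k) = 0.
  by apply: pderiv_expM_eq0 => //; rewrite cardsT card_ord.
rewrite addr0 coef_sum exchange_big; apply: eq_bigr => j _.
rewrite coefM [LHS](bigID (fun S => S \in upsets l)) /=.
rewrite [X in _ + X]big1 ?addr0 // => S SQ.
have [lS|lS] := boolP (l \in S); last first.
  rewrite /coef (@pderiv_eq0 _ _ _ _ (~: S) l) ?inE ?rmorph0 ?mulr0 //.
  move/mxOverP/(_ j k)/free_ofP: freeE; apply.
  by rewrite /dir /tdir /tvar /= enum_rankK.
have /subsetPn[m] : ~~ (S :\ l \subset [set m : 'I_d | (l < m)%N]).
  apply: contra SQ => sS; apply/imsetP; exists (S :\ l); last by rewrite setD1K.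
  by rewrite powersetE.
rewrite !inE -leqNgt leq_eqVlt val_eqE => /andP[ml mS]; rewrite (negPf ml) /= => lm.
rewrite /coef (@pderiv_eq0 _ _ _ _ S m) ?rmorph0 ?mul0r //.
move/mxOverP/(_ 0 j)/free_ofP: freew; apply.
by rewrite /below /tdir /tvar /= enum_rankK.
Qed.

Lemma tau_decomposition x f : (0 < d)%N -> lifts 0 x ->
  tau f = \sum_l \row_k coef f setT (corr x l 0 k).
Proof.
move=> d0 Lx; apply/rowP=> k; rewrite -coef_teval_y (teval_telescope x).
have jr : (0 <= 0 < d)%N by rewrite d0.
have -> : teval tau cst x = 0.
  rewrite -[RHS](lifts_vanish Lx jr); congr teval.
  by apply/ffunP=> l; rewrite ffunE.
rewrite add0r !summxE coef_sum; apply: eq_bigr => l _.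
by rewrite [RHS]mxE.
Qed.
End Lift.

(** * Upper bounds for the partition rank *)

Section PRBound.
Variables (F : fieldType) (V : vectType F) (d : nat).
Implicit Type T : {ffun 'I_d -> V} -> V.

(** T is a sum of at most m reducible tensors. Unlike the values of [PR], this can be
manipulated without knowing that T is multilinear. *)
Definition PR_le T (m : nat) : Prop :=
  exists2 s : nat, (s <= m)%N & sum_of_reducible T s.

Lemma PR_le_PR T m : (0 < d)%N -> multilinear T -> PR_le T m -> (PR T <= m)%N.
Proof.
move=> d0 hT [s sm hs]; apply: leq_trans sm.
by have [_ ->] := PRP d0 hT.
Qed.

Lemma eq_PR_le T T' m : T =1 T' -> PR_le T' m -> PR_le T m.
Proof.
move=> TT' [s sm [S [hS eS]]]; exists s => //; exists S.
by split=> // x; rewrite TT'.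
Qed.

Lemma PR_le_0 : PR_le (fun=> 0) 0.
Proof.
by exists 0%N => //; exists (fun _ _ => 0); split=> [[]//|x]; rewrite big_ord0.
Qed.

Lemma PR_le_add T1 T2 m1 m2 :
  PR_le T1 m1 -> PR_le T2 m2 -> PR_le (fun x => T1 x + T2 x) (m1 + m2).
Proof.
move=> [s1 sm1 [S1 [hS1 eS1]]] [s2 sm2 [S2 [hS2 eS2]]].
exists (s1 + s2)%N; first exact: leq_add.
exists (fun k => match split k with inl a => S1 a | inr a => S2 a end).
split=> [k|x]; first by case: split.
rewrite big_split_ord eS1 eS2 /=; congr (_ + _); apply: eq_bigr => k _.
  by rewrite (unsplitK (inl k)).
by rewrite (unsplitK (inr k)).
Qed.

Lemma PR_le_sum (J : Type) (s : seq J) (P : pred J) (T : J -> {ffun 'I_d -> V} -> V)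
    (m : J -> nat) :
  (forall j, P j -> PR_le (T j) (m j)) ->
  PR_le (fun x => \sum_(j <- s | P j) T j x) (\sum_(j <- s | P j) m j).
Proof.
move=> hT; elim: s => [|j s IHs].
  by rewrite big_nil; apply: eq_PR_le PR_le_0 => x; rewrite big_nil.
rewrite big_cons; case: ifP => Pj.
  apply: eq_PR_le (PR_le_add (hT j Pj) IHs) => x; by rewrite big_cons Pj.
by apply: eq_PR_le IHs => x; rewrite big_cons Pj.
Qed.

Lemma restr_upd (A : {set 'I_d}) (x : {ffun 'I_d -> V}) i (iA : i \in A) v :
  restr A (upd x i v) = upd (restr A x) (exist _ i iA) v.
Proof. by apply/ffunP=> j; rewrite !ffunE -val_eqE. Qed.

Lemma restr_updN (A : {set 'I_d}) (x : {ffun 'I_d -> V}) i v :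
  i \notin A -> restr A (upd x i v) = restr A x.
Proof.
move=> iA; apply/ffunP=> -[j jA]; rewrite !ffunE /=.
by case: eqP jA iA => // -> ->.
Qed.

Section Split.
Variables (A : {set 'I_d}) (P : {ffun {i : 'I_d | i \in A} -> V} -> F^o).
Variable T' : {ffun {i : 'I_d | i \in ~: A} -> V} -> V.
Hypotheses (hP : multilinear P) (hT' : multilinear T').

Lemma multilinear_split :
  multilinear (fun x : {ffun 'I_d -> V} => P (restr A x) *: T' (restr (~: A) x)).
Proof.
move=> x i a u v; have [iA|iA] := boolP (i \in A).
  have iA' : i \notin ~: A by rewrite inE iA.
  rewrite !(restr_upd _ iA) !(restr_updN _ _ iA').
  have e := hP (restr A x) (exist _ i iA) a u v.
  apply: (etrans (congr1 (fun c : F => c *: T' (restr (~: A) x)) e)).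
  by rewrite scalerDl -scalerA.
have iA' : i \in ~: A by rewrite inE.
rewrite !(restr_upd _ iA') !(restr_updN _ _ iA).
have e := hT' (restr (~: A) x) (exist _ i iA') a u v.
apply: (etrans (congr1 (fun t : V => P (restr A x) *: t) e)).
by rewrite scalerDr !scalerA mulrC.
Qed.

Lemma PR_le_split : A != set0 ->
  PR_le (fun x => P (restr A x) *: T' (restr (~: A) x)) 1.
Proof.
move=> A0; pose T x := P (restr A x) *: T' (restr (~: A) x).
have [nz|z] := boolp.pselect (exists x, T x != 0); last first.
  case: PR_le_0 => s s0 hs; exists s; first by apply: leq_trans s0 _.
  have [S [hS eS]] := hs; exists S; split=> // x; rewrite -eS.
  by apply/eqP/negPn/negP=> nz; apply: z; exists x.
exists 1%N => //; exists (fun=> T); split=> [_|x]; last by rewrite big_ord1.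
split=> //; first exact: multilinear_split.
by exists A; split=> //; exists P, T'.
Qed.

End Split.
End PRBound.

Section Arrays.
Variables (F : fieldType) (V : vectType F).
Local Notation n := (\dim {:V}).
Local Notation b := (fun k : 'I_n => (vbasis {:V})`_k).

(** The tuple of basis vectors with indices f *)
Definition btuple (I : finType) (f : {ffun I -> 'I_n}) : {ffun I -> V} :=
  [ffun i => b (f i)].

(** The multilinear map with prescribed values on tuples of basis vectors *)
Definition of_array (I : finType) (W : lmodType F) (a : {ffun I -> 'I_n} -> W)
    (x : {ffun I -> V}) : W :=
  \sum_(f : {ffun I -> 'I_n}) (\prod_i coord (vbasis {:V}) (f i) (x i)) *: a f.

Lemma multilinear_of_array (I : finType) (W : lmodType F) (a : {ffun I -> 'I_n} -> W) :
  multilinear (of_array a).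
Proof.
apply: multilinear_sum => f x i c u v; rewrite scalerA -scalerDl; congr (_ *: _).
have eq_i t : \prod_j coord (vbasis {:V}) (f j) (upd x i t j)
  = coord (vbasis {:V}) (f i) t
    * \prod_(j | j != i) coord (vbasis {:V}) (f j) (x j).
  rewrite (bigD1 i) //= ffunE eqxx; congr (_ * _).
  by apply: eq_bigr => j /negPf ji; rewrite ffunE ji.
by rewrite !eq_i linearP mulrDl mulrA.
Qed.

Lemma of_array_btuple (I : finType) (W : lmodType F) (a : {ffun I -> 'I_n} -> W) f :
  of_array a (btuple f) = a f.
Proof.
rewrite /of_array (bigD1 f) //= big1 => [|i _]; last first.
  by rewrite ffunE coord_free ?(basis_free (vbasisP _)) ?eqxx.
rewrite scale1r big1 ?addr0 // => g gf.
have /existsP[i gi] : [exists i, g i != f i].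
  apply: contraR gf; rewrite negb_exists => /forallP h.
  by apply/eqP/ffunP=> i; apply/eqP/negPn.
rewrite (bigD1 i) //= ffunE coord_free ?(basis_free (vbasisP _)) //.
by rewrite eq_sym (negPf gi) mul0r scale0r.
Qed.

Lemma multilinear_ext_btuple (I : finType) (W : lmodType F) (T T' : {ffun I -> V} -> W) :
  multilinear T -> multilinear T' ->
  (forall f, T (btuple f) = T' (btuple f)) -> T =1 T'.
Proof.
apply: multilinear_ext => v; exists (fun k => coord (vbasis {:V}) k v).
exact: (coord_vbasis (memvf v)).
Qed.

Variable d : nat.

(** An array that factors into a part depending on the indices in A and a part
depending on the others gives a reducible tensor or 0. *)
Lemma PR_le_array (A : {set 'I_d}) (a : {ffun 'I_d -> 'I_n} -> V)
    (c : {ffun 'I_d -> 'I_n} -> F) (e : {ffun 'I_d -> 'I_n} -> V) :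
  A != set0 ->
  (forall f g : {ffun 'I_d -> 'I_n}, {in A, f =1 g} -> c f = c g) ->
  (forall f g : {ffun 'I_d -> 'I_n}, {in ~: A, f =1 g} -> e f = e g) ->
  (forall f, a f = c f *: e f) -> PR_le (of_array a) 1.
Proof.
move=> A0 hc he ae.
(* Extending a partial index tuple to all of 'I_d requires a default tuple, which
   exists unless V = 0. *)
have [f0 _|nof] := pickP (predT : pred {ffun 'I_d -> 'I_n}); last first.
  case: (@PR_le_0 F V d) => s s0 hs; apply: (@eq_PR_le _ _ _ _ (fun=> 0)) => [x|].
    by rewrite /of_array big1 // => f; have := nof f.
  by exists s => //; apply: leq_trans s0 _.
pose ext (B : {set 'I_d}) (h : {ffun {i : 'I_d | i \in B} -> 'I_n}) :
  {ffun 'I_d -> 'I_n} := [ffun l => if insub l is Some u then h u else f0 l].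
pose P := of_array (fun h => c (ext A h) : F^o).
pose T' := of_array (fun h => e (ext (~: A) h)).
have hP : multilinear P by exact: multilinear_of_array.
have hT' : multilinear T' by exact: multilinear_of_array.
apply: eq_PR_le (PR_le_split hP hT' A0).
apply: multilinear_ext_btuple => [||f]; first exact: multilinear_of_array.
  exact: multilinear_split.
have rE B : restr B (btuple f) = btuple [ffun u => f (val u)].
  by apply/ffunP=> u; rewrite !ffunE.
have extE (B : {set 'I_d}) (f' : {ffun 'I_d -> 'I_n}) :
    {in B, f' =1 ext B [ffun u => f' (val u)]}.
  by move=> l lB; rewrite !ffunE insubT /= ffunE.
rewrite !rE /P /T' !of_array_btuple ae.
by rewrite (hc _ _ (extE A f)) (he _ _ (extE (~: A) f)).
Qed.

End Arrays.

(** * Coordinates *)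

Section Coordinates.
Import VectorInternalTheory.

(** The rank of an endomorphism can be read off its matrix in any coordinates. *)
Lemma dim_limg (K : fieldType) (V : vectType K) m (c : {linear V -> 'rV[K]_m})
    (f : 'End(V)) (M : 'M[K]_m) :
  bijective c -> (forall v, c (f v) = c v *m M) -> \dim (limg f) = \rank M.
Proof.
move=> [c' cK c'K] cf; pose N := lin1_mx (c \o r2v).
have cE u : u *m N = c (r2v u) by rewrite mul_rV_lin1.
have fN : f2mx f *m N = N *m M.
  apply/row_matrixP=> k; rewrite !row_mul !rowE !cE -cf; congr (c _).
  by rewrite unlock /= r2vK.
have Nfree : row_free N.
  apply: inj_row_free => u; rewrite cE => /(congr1 c'); rewrite cK.
  rewrite -(linear0 c) cK => /(congr1 v2r).
  by rewrite r2vK linear0.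
have Nfull : row_full N.
  apply/row_fullP; exists (\matrix_k v2r (c' (delta_mx 0 k))).
  by apply/row_matrixP=> k; rewrite row_mul rowK cE v2rK c'K row1.
have -> : \dim (limg f) = \rank (f2mx f).
  rewrite unlock /dimv /fullv !genmxE.
  by rewrite (eqmxMr _ (genmxE _)) mul1mx.
by rewrite -(mxrankMfree _ Nfree) fN (eqmxMfull _ Nfull).
Qed.

Variables (F : fieldType) (V : vectType F) (d : nat) (T : {ffun 'I_d -> V} -> V).
Hypothesis hT : multilinear T.
Local Notation n := (\dim {:V}).
Local Notation idF := (idfun : {rmorphism F -> F}).

(** The array of values of T on basis vectors, in coordinates *)
Definition tcoord (f : {ffun 'I_d -> 'I_n}) : 'rV[F]_n :=
  \row_k coord (vbasis {:V}) k (T (btuple f)).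

(** The vector with given coordinates *)
Definition vec_of (r : 'rV[F]_n) : V := \sum_k r 0 k *: (vbasis {:V})`_k.

Lemma vec_ofK v : vec_of (\row_k coord (vbasis {:V}) k v) = v.
Proof.
rewrite {2}(coord_vbasis (memvf v)); apply: eq_bigr => k _.
by rewrite mxE.
Qed.

Lemma vec_of_linear : linear vec_of.
Proof.
move=> a u v; rewrite /vec_of scaler_sumr -big_split; apply: eq_bigr => k _.
by rewrite !mxE scalerDl scalerA.
Qed.

HB.instance Definition _ := GRing.isLinear.Build F 'rV[F]_n V _ vec_of vec_of_linear.

Lemma ext_tensorE (K : fieldType) (iota : {rmorphism F -> K}) x :
  ext_tensor iota T x = teval tcoord iota x.
Proof.
apply: eq_bigr => f _; congr (_ *: _); apply/rowP=> k.
by rewrite !mxE.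
Qed.

Lemma ext_slice_rank (K : fieldType) (iota : {rmorphism F -> K}) x i :
  slice_rank (ext_tensor iota T) x i = \rank (tslice tcoord iota x i).
Proof.
apply: (@dim_limg _ _ _ idfun) => [|v]; first by exists id.
rewrite linfun_sliceE; last exact: multilinear_ext_tensor.
by rewrite ext_tensorE -teval_rupd.
Qed.

Lemma slice_rankE x i :
  slice_rank T x i = \rank (tslice tcoord idF (ext_point idF x) i).
Proof.
pose c (v : V) : 'rV[F]_n := ext_vec idF v.
have cl : linear c by move=> a u v; apply/rowP=> k; rewrite !mxE linearP.
pose cM := GRing.isLinear.Build F V 'rV[F]_n _ c cl.
pose cL : {linear V -> 'rV[F]_n} := HB.pack c cM.
apply: (@dim_limg _ _ _ cL) => [|v].
  exists vec_of => [v|r]; first exact: vec_ofK.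
  apply/rowP=> k; rewrite mxE linear_sum (bigD1 k) //= big1 => [|j jk].
    by rewrite linearZ /= coord_free ?(basis_free (vbasisP _)) // eqxx mulr1 addr0.
  rewrite linearZ /= coord_free ?(basis_free (vbasisP _)) //.
  by rewrite (negPf jk) mulr0.
rewrite linfun_sliceE // /= /c -ext_tensor_ext_point // ext_tensorE -teval_rupd.
congr teval; apply/ffunP=> j; rewrite !ffunE.
by case: eqP.
Qed.

End Coordinates.

Theorem mainTheorem6 (F : fieldType) (K : closedFieldType)
    (iota : {rmorphism F -> K}) (hK : is_algebraic_closure iota)
    (V : vectType F) (d : nat) (hd : (1 <= d)%N)
    (T : {ffun 'I_d -> V} -> V) (hT : multilinear T)
    (p : {ffun 'I_d -> V}) (hp : LR_stable iota T p) :
  (PR T <= wnorm (LR T p))%N.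
Proof.
have [[q0 [q0_van q0_rank]] _] := LRP p hT.
have [_] := LRP (ext_point iota p) (multilinear_ext_tensor iota T).
rewrite -hp => x_max.
pose idF : {rmorphism F -> F} := idfun.
pose tau := tcoord T; pose pc := ext_point idF p.
(* The first vector of q0 is irrelevant to the ranks; setting it to 0 also makes T
   vanish at q. *)
pose q : {ffun 'I_d -> 'rV[F]_(\dim {:V})} :=
  [ffun i : 'I_d => if i == 0%N :> nat then 0 else ext_vec idF (q0 i)].
have hybE j : (0 < j)%N -> rhyb pc j q = ext_point idF (hyb p j q0).
  move=> j0; apply/ffunP=> l; rewrite !ffunE; case: ltnP => // jl.
  by rewrite eqn_leq leqNgt (leq_trans j0 jl).
have q_van (j : 'I_d) : teval tau idF (rhyb pc j q) = 0.
  have [j0|j0] := posnP j.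
    by apply: (@teval_eq0 _ _ _ _ _ _ _ j); rewrite !ffunE j0.
  have jr : (0 < j < d)%N by rewrite j0 ltn_ord.
  rewrite hybE // -ext_tensorE ext_tensor_ext_point // (q0_van _ jr).
  by apply/rowP=> k; rewrite !mxE linear0.
have rankE l : prank tau pc q l = LR T p l.
  by rewrite -q0_rank ffunE slice_rankE // /prank /pslice hybE.
have pK : rmap iota pc = ext_point iota p.
  by apply/ffunP=> l; apply/rowP=> k; rewrite !ffunE !mxE.
have r_max (x : {ffun 'I_d -> 'rV[K]_(\dim {:V})}) :
    (forall j : nat, (0 < j < d)%N -> teval tau iota (rhyb (rmap iota pc) j x) = 0) ->
    colex_le [ffun l : 'I_d => \rank (tslice tau iota (rhyb (rmap iota pc) l.+1 x) l)]
             [ffun l => prank tau pc q l].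
  rewrite pK => x_van; have := x_max x; have -> : LR T p = [ffun l => prank tau pc q l].
    by apply/ffunP=> l; rewrite ffunE rankE.
  have -> : rank_vector (ext_tensor iota T) (ext_point iota p) x
     = [ffun l : 'I_d => \rank (tslice tau iota (rhyb (ext_point iota p) l.+1 x) l)].
    by apply/ffunP=> l; rewrite !ffunE ext_slice_rank.
  by move=> h; apply: h => i id; rewrite ext_tensorE; apply: x_van.
have [x Lx] := lifts_exists q_van r_max.
apply: PR_le_PR => //; pose a l f := vec_of (\row_k coef f setT (corr tau q x l 0 k)).
apply: (@eq_PR_le _ _ _ _ (fun z => \sum_l of_array (a l) z)).
  apply: multilinear_ext_btuple => // [|f].
    apply: (@multilinear_sum _ _ _ _ _ (fun l => of_array (a l))) => l.
    exact: multilinear_of_array.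
  under eq_bigr do rewrite of_array_btuple.
  by rewrite -linear_sum -(tau_decomposition f hd Lx) /= vec_ofK.
apply: PR_le_sum => l _; have [w [E wE]] := coef_corr l Lx.
pose aS S j f := coef f S (w 0 j) *: vec_of (\row_k coef f (~: S) (E j k)).
apply: (@eq_PR_le _ _ _ _ (fun z => \sum_(S in upsets l) \sum_j of_array (aS S j) z)).
  apply: multilinear_ext_btuple => [||f]; first exact: multilinear_of_array.
    move=> z i c u v; rewrite scaler_sumr -big_split; apply: eq_bigr => S _.
    apply: (@multilinear_sum _ _ _ _ _ (fun j => of_array (aS S j))) => j.
    exact: multilinear_of_array.
  rewrite of_array_btuple; under eq_bigr do under eq_bigr do rewrite of_array_btuple.
  rewrite /a; have -> : \row_k coef f setT (corr tau q x l 0 k)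
      = \sum_(S in upsets l) \sum_j coef f S (w 0 j) *: \row_k coef f (~: S) (E j k).
    apply/rowP=> k; rewrite mxE wE summxE; apply: eq_bigr => S _.
    by rewrite summxE; apply: eq_bigr => j _; rewrite !mxE.
  rewrite linear_sum; apply: eq_bigr => S _.
  by rewrite linear_sum; apply: eq_bigr => j _; rewrite linearZ.
have -> : (2 ^ (d - l.+1) * LR T p l
    = \sum_(S in upsets l) \sum_(j < prank tau pc q l) 1)%N.
  by rewrite sum1_card card_ord sum_nat_const card_upsets rankE.
apply: PR_le_sum => S SU; apply: PR_le_sum => j _.
apply: (@PR_le_array _ _ _ S _ (fun f => coef f S (w 0 j))
  (fun f => vec_of (\row_k coef f (~: S) (E j k)))) => [|f g fg|f g fg|//].
- by case/imsetP: SU => A _ ->; apply/set0Pn; exists l; rewrite setU11.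
- exact: eq_coef.
- by congr vec_of; apply/rowP=> k; rewrite !mxE (eq_coef _ fg).
Qed.
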